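(* Let $N,m,c$ be integers with $1\le c\le m<N$ and $c\le N-m$, and let $Y$ have the maximum negative hypergeometric distribution with parameters $(N,m,c)$. Then $$\frac{\Pr[Y=0]}{\Pr[Y=1]}=\frac{c+1}{c},$$ which shows that the distribution always has at least one local mode at $Y=0$.
   Context: For a real number $z$ and integer $k\ge1$, $z^{(k)}=z(z-1)\cdots(z-k+1)$ is the falling factorial, and $z^{(0)}=1$. Maximum negative hypergeometric distribution with integer parameters $(N,m,c)$, where $1\le c\le m<N$ and $c\le N-m$: an urn contains $N$ balls, $m$ of one color and $N-m$ of another; balls are drawn without replacement until at least $c$ balls of both colors have been observed; $Y$ is the number of draws needed minus $2c$. Its probability mass function is $$\Pr[Y=y]=\binom{2c+y-1}{c-1}\,\frac{m^{(c+y)}(N-m)^{(c)}+m^{(c)}(N-m)^{(c+y)}}{N^{(2c+y)}},\qquad 0\le y\le\max\{m-c,\,N-m-c\}.$$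
   Formalization: The ratio is stated only when y = 1 lies in the range 0 ≤ y ≤ max{m−c, N−m−c}; in the excluded case N = 2c (m = c) one has Pr[Y=1] = 0 and the ratio is undefined. The local mode at Y = 0 is stated in all cases. *)

(* Defs.v *)
From HB Require Import structures.
From mathcomp Require Import all_boot all_order all_algebra all_fingroup.
From mathcomp Require Import all_classical all_reals all_analysis.

Set Implicit Arguments.
Unset Strict Implicit.
Unset Printing Implicit Defensive.

Import Order.TTheory GRing.Theory Num.Theory.

Local Open Scope ring_scope.

(* Drawing all N balls without replacement is a permutation s of 'I_N, the
   ball s i being drawn at step i + 1. Balls 0, ..., m - 1 are of one color,
   balls m, ..., N - 1 of the other. *)

Definition seen1 (N m : nat) (s : 'S_N) (n : nat) : nat :=
  #|[set i : 'I_N | (i < n)%N && (s i < m)%N]|.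

Definition seen2 (N m : nat) (s : 'S_N) (n : nat) : nat :=
  #|[set i : 'I_N | (i < n)%N && (m <= s i)%N]|.

Definition seen_both (N m c : nat) (s : 'S_N) (n : nat) : bool :=
  (c <= seen1 m s n)%N && (c <= seen2 m s n)%N.

(* The least n <= N such that seen_both m c s n; it exists whenever c <= m
   and c <= N - m. *)
Definition draws (N m c : nat) (s : 'S_N) : nat :=
  find (seen_both m c s) (iota 0 N.+1).

(* Probability, over a uniformly random order of the balls, that the number of
   draws needed minus 2c is y. *)
Definition max_neghyp_prob (R : realType) (N m c y : nat) : R :=
  #|[set s : 'S_N | draws m c s == (2 * c + y)%N]|%:R / #|[set: 'S_N]|%:R.

Definition max_neghyp (R : realType) (d : measure_display)
    (T : measurableType d) (P : probability T R) (N m c : nat)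
    (Y : {RV P >-> nat}) : Prop :=
  forall y : nat, distribution P Y [set y]%classic = (max_neghyp_prob R N m c y)%:E.

Definition Pr (R : realType) (d : measure_display) (T : measurableType d)
    (P : probability T R) (Y : {RV P >-> nat}) (y : nat) : R :=
  fine (P (Y @^-1` [set y])%classic).

(* k = 0 has only the neighbor 1, since a nat-valued variable gives no mass to
   -1. *)
Definition is_local_mode (R : realType) (p : nat -> R) (k : nat) : Prop :=
  forall j : nat, j = k.+1 \/ j.+1 = k -> p j < p k.

(* Main.v *)
Require Import Defs.
From HB Require Import structures.
From mathcomp Require Import all_boot all_order all_algebra all_fingroup.
From mathcomp Require Import all_classical all_reals all_analysis.
From mathcomp Require Import zify.

Import Order.TTheory GRing.Theory Num.Theory.

Local Open Scope ring_scope.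

(** Both events [Y = 0] and [Y = 1] lie in the event that [2c + 1] draws
    suffice, in which the first [2c + 1] balls consist of [c + 1] balls of a
    majority color and [c] of the other. Given this event, [Y = 0] says that
    the ball drawn at step [2c + 1] is of the majority color
    ([draws_eq0_majority]). The order of drawing is exchangeable, so that ball
    is equally likely to be any of the [2c + 1] balls ([card_exchange]): it is
    of the majority color for a fraction [(c + 1) / (2c + 1)] of the orders and
    of the minority color for the remaining [c / (2c + 1)], whence the ratio
    [(c + 1) / c] ([card_draws_ratio]). The order that draws [c] balls of each
    color first shows that [Y = 0] has positive probability
    ([card_draws0_gt0]), so [Pr Y 1 < Pr Y 0]; when [N = 2c] this holds
    because [Y = 1] is impossible. *)

(** A double count of the pairs [(s, i)] with [Q s i]: exchanging positions [i]
    and [k] is a bijection between the [s] with [Q s i] and those with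
    [Q s k], so every position [i] of the window [W] contributes equally. *)
Lemma card_exchange (T : finType) (W : {set T}) (B : {set {perm T}})
    (Q : {perm T} -> pred T) (r : nat) (k : T) :
  (forall i s, i \in W -> ((tperm i k * s)%g \in B) = (s \in B)) ->
  (forall i s, i \in W -> Q (tperm i k * s)%g k = Q s i) ->
  (forall s, s \in B -> #|[set i in W | Q s i]| = r) ->
  (#|W| * #|[set s in B | Q s k]| = #|B| * r)%N.
Proof.
move=> BW QW Qr.
have -> : (#|B| * r = \sum_(s in B) \sum_(i in W | Q s i) 1)%N.
  rewrite -sum_nat_const; apply: eq_bigr => s sB.
  by rewrite -(Qr s sB) -sum1_card; apply: eq_bigl => i; rewrite inE.
rewrite (exchange_big_dep (mem W)) /=; last by move=> s i _ /andP[].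
rewrite -sum_nat_const; apply: eq_bigr => i iW.
have -> : (\sum_(s in B | (i \in W) && Q s i) 1 =
           #|[set s in B | Q s i]|)%N.
  by rewrite -sum1_card; apply: eq_bigl => s; rewrite inE iW.
rewrite -(card_imset _ (@mulgI _ (tperm i k))); apply: eq_card => s.
rewrite [RHS]inE; apply/imsetP/andP => [[u] | [sB Qs]].
  rewrite inE => /andP[uB Qu] ->; rewrite BW // uB; split=> //.
  by rewrite -QW // mulgA tperm2 mul1g.
exists (tperm i k * s)%g; last by rewrite mulgA tperm2 mul1g.
by rewrite inE BW // sB QW.
Qed.

Section Urn.
Set Implicit Arguments.
Unset Strict Implicit.
Variables (N m : nat).
Implicit Types (s : 'S_N) (n c : nat).

Lemma widen_ord_inj n p (np : (n <= p)%N) : injective (widen_ord np).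
Proof. by move=> i j /(congr1 val) ij; apply: val_inj. Qed.

Lemma card_ord_ltn n : (n <= N)%N -> #|[set i : 'I_N | (i < n)%N]| = n.
Proof.
move=> nN; rewrite -[RHS]card_ord -(card_imset _ (@widen_ord_inj _ _ nN)).
apply: eq_card => i; rewrite inE; apply/idP/imsetP => [lt_in | [j _ ->]] //=.
by exists (Ordinal lt_in) => //; apply: val_inj.
Qed.

Lemma seen1D2 s n : (n <= N)%N -> (seen1 m s n + seen2 m s n = n)%N.
Proof.
move=> nN; rewrite -[RHS]card_ord_ltn //.
rewrite -(cardsID [set i | (s i < m)%N] [set i : 'I_N | (i < n)%N]).
by congr addn; apply: eq_card => i; rewrite !inE // andbC -leqNgt.
Qed.

Lemma seen1S s (k : 'I_N) : seen1 m s k.+1 = ((s k < m) + seen1 m s k)%N.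
Proof.
rewrite /seen1 (cardsD1 k) !inE ltnSn /=; congr addn.
apply: eq_card => i; rewrite !inE ltnS.
by rewrite [(i < k)%N]ltn_neqAle andbA; congr andb.
Qed.

Lemma seen_both_mono c s n p :
  (n <= p)%N -> seen_both m c s n -> seen_both m c s p.
Proof.
move=> np /andP[h1 h2]; apply/andP; split.
- apply: leq_trans h1 _; apply/subset_leq_card/fintype.subsetP => i.
  by rewrite !inE => /andP[/leq_trans-> ].
- apply: leq_trans h2 _; apply/subset_leq_card/fintype.subsetP => i.
  by rewrite !inE => /andP[/leq_trans-> ].
Qed.

Lemma draws_leq c s n : (n <= N)%N -> (draws m c s <= n)%N = seen_both m c s n.
Proof.
move=> nN; apply/idP/idP => [dn | sn].
  have dlt : (draws m c s < size (iota 0 N.+1))%N.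
    by rewrite size_iota ltnS (leq_trans dn).
  have := dlt; rewrite -has_find => /(nth_find 0%N).
  rewrite -/(draws m c s) nth_iota; first exact: seen_both_mono.
  by move: dlt; rewrite size_iota.
rewrite leqNgt; apply/negP => /(before_find 0%N).
by rewrite nth_iota ?ltnS // add0n sn.
Qed.

Lemma seen_both_geq c s n : (n <= N)%N -> seen_both m c s n -> (2 * c <= n)%N.
Proof. by move=> nN /andP[]; have := seen1D2 s nN; lia. Qed.

Lemma draws_eq0 c s : (2 * c <= N)%N ->
  (draws m c s == 2 * c + 0)%N = seen_both m c s (2 * c).
Proof.
move=> cN; rewrite addn0 eqn_leq draws_leq //.
case: ltnP => [lt_d | _]; rewrite ?andbT // andbF.
have dN : (draws m c s <= N)%N by lia.
have := leqnn (draws m c s).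
by rewrite draws_leq // => /(seen_both_geq dN); lia.
Qed.

Lemma draws_eq1 c s : (2 * c < N)%N ->
  (draws m c s == 2 * c + 1)%N =
  seen_both m c s (2 * c).+1 && ~~ seen_both m c s (2 * c).
Proof.
by move=> cN; rewrite addn1 eqn_leq -(draws_leq _ _ cN) -(draws_leq _ _ (ltnW cN)) -ltnNge.
Qed.

(** Among [2c + 1] balls having [c] of each color, the first color is the
    majority exactly when more than [c] balls have it. *)
Definition majority c s : pred 'I_N :=
  fun i => (s i < m)%N == (c < seen1 m s (2 * c).+1)%N.

Lemma card_majority c s : (2 * c < N)%N -> seen_both m c s (2 * c).+1 ->
  #|[set i in [set i : 'I_N | (i < (2 * c).+1)%N] | majority c s i]| = c.+1.
Proof.
move=> cN /andP[h1 h2]; have := seen1D2 s cN; move: h1 h2.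
rewrite /majority; case: ltnP => [lt_c | le_c] h1 h2 D.
- transitivity (seen1 m s (2 * c).+1); last by lia.
  by apply: eq_card => i; rewrite !inE eqb_id.
- transitivity (seen2 m s (2 * c).+1); last by lia.
  by apply: eq_card => i; rewrite !inE eqbF_neg -leqNgt.
Qed.

(** Removing a majority ball from [c + 1] and [c] balls leaves [c] of each
    color; removing a minority ball leaves only [c - 1] of that color. *)
Lemma draws_eq0_majority c s (k : 'I_N) : k = (2 * c)%N :> nat ->
  seen_both m c s (2 * c) = seen_both m c s (2 * c).+1 && majority c s k.
Proof.
move=> kE; have kN := ltn_ord k; rewrite kE in kN.
have D0 := seen1D2 s (ltnW kN); have D1 := seen1D2 s kN.
have := seen1S s k; rewrite kE => S1.
by rewrite /seen_both /majority; case: (s k < m)%N S1 => /=; lia.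
Qed.

Lemma seen1_tperm s n (i k : 'I_N) : (i < n)%N -> (k < n)%N ->
  seen1 m (tperm i k * s)%g n = seen1 m s n.
Proof.
move=> lt_in lt_kn; rewrite /seen1 -[RHS](card_imset _ (@perm_inj _ (tperm i k))).
apply: eq_card => j; rewrite -{1 2}[j](tpermK i k) mem_imset; last exact: perm_inj.
by rewrite !inE permM tpermK; case: tpermP => [->|->|]; rewrite ?lt_in ?lt_kn.
Qed.

Lemma seen_both_tperm c s n (i k : 'I_N) : (n <= N)%N -> (i < n)%N -> (k < n)%N ->
  seen_both m c (tperm i k * s)%g n = seen_both m c s n.
Proof.
move=> nN lt_in lt_kn; rewrite /seen_both.
have := seen1D2 s nN; have := seen1D2 (tperm i k * s)%g nN.
by rewrite seen1_tperm //; lia.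
Qed.

(** If [a] and [b] are the two cardinals, exchangeability within the first
    [2c + 1] positions gives [(2c + 1) a = (c + 1) (a + b)]. *)
Lemma card_draws_ratio c : (2 * c < N)%N ->
  (c * #|[set s : 'S_N | draws m c s == 2 * c + 0]| =
   c.+1 * #|[set s : 'S_N | draws m c s == 2 * c + 1]|)%N.
Proof.
move=> cN; pose k := Ordinal cN.
pose B := [set s : 'S_N | seen_both m c s (2 * c).+1].
pose M := [set s : 'S_N | majority c s k].
have E0 : [set s : 'S_N | draws m c s == 2 * c + 0]%N = B :&: M.
  apply/setP => s; rewrite !inE draws_eq0 1?ltnW //.
  exact: draws_eq0_majority.
have E1 : [set s : 'S_N | draws m c s == 2 * c + 1]%N = B :\: M.
  apply/setP => s; rewrite !inE draws_eq1 // (@draws_eq0_majority _ _ k) //.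
  by case: seen_both; rewrite ?andbF ?andbT.
have := @card_exchange _ [set i : 'I_N | (i < (2 * c).+1)%N] B (majority c) c.+1 k.
rewrite card_ord_ltn //.
have -> : [set s in B | majority c s k] = B :&: M by apply/setP => s; rewrite !inE.
rewrite E0 E1 -(cardsID M B) => H; suff: ((2 * c).+1 * #|B :&: M|
  = (#|B :&: M| + #|B :\: M|) * c.+1)%N by nia.
apply: H => [i s | i s | s]; rewrite inE => hi.
- by rewrite !inE seen_both_tperm //=.
- by rewrite /majority permM tpermR seen1_tperm //=.
- exact: card_majority.
Qed.

(** The block of positions [c, ..., m + c - 1] is rotated so that balls
    [m, ..., m + c - 1] are drawn right after balls [0, ..., c - 1]. *)
Lemma card_draws0_gt0 c : (c <= m)%N -> (m + c <= N)%N ->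
  (0 < #|[set s : 'S_N | draws m c s == 2 * c + 0]|)%N.
Proof.
move=> cm mcN.
pose f i := (if i < c then i else if i < 2 * c then i - c + m
             else if i < m + c then i - c else i)%N.
have fN (i : 'I_N) : (f i < N)%N.
  by have := ltn_ord i; rewrite /f; do !case: ifP; lia.
pose g i := Ordinal (fN i).
have g_inj : injective g.
  move=> i j /(congr1 val) /=; rewrite /f => fij; apply: val_inj => /=.
  by move: fij; do !case: ifP; lia.
apply/card_gt0P; exists (perm g_inj); rewrite inE draws_eq0; last by lia.
have cN : (c <= N)%N by lia.
have ccN : (c + c <= N)%N by lia.
apply/andP; split; rewrite -{1}[c]card_ord.
- rewrite -(card_imset _ (@widen_ord_inj _ _ cN)).
  apply/subset_leq_card/fintype.subsetP => _ /imsetP[i _ ->].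
  by rewrite inE permE /= /f; have := ltn_ord i; do !case: ifP; lia.
- rewrite -(card_imset _ (inj_comp (@widen_ord_inj _ _ ccN) (@rshift_inj c c))).
  apply/subset_leq_card/fintype.subsetP => _ /imsetP[i _ ->].
  by rewrite inE permE /= /f; have := ltn_ord i; do !case: ifP; lia.
Qed.

(** The search over [0, ..., N] that defines [draws] does not fail: failure
    would give the value [N + 1], which for [N = 2c] would pass for
    [2c + 1]. *)
Lemma draws_leqN c s : (c <= m)%N -> (m + c <= N)%N -> (draws m c s <= N)%N.
Proof.
move=> cm mcN; rewrite draws_leq //.
have mN : (m <= N)%N by lia.
have E : seen1 m s N = m.
  rewrite -[RHS](card_ord_ltn mN) -[LHS](card_imset _ (@perm_inj _ s)).
  apply: eq_card => i; rewrite -[i](permKV s) mem_imset; last exact: perm_inj.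
  by rewrite !inE permKV ltn_ord.
by rewrite /seen_both; have := seen1D2 s (leqnn N); rewrite E; lia.
Qed.

End Urn.

Theorem mainTheorem5 (R : realType) (d : measure_display)
    (T : measurableType d) (P : probability T R) (N m c : nat)
    (Y : {RV P >-> nat})
    (hc : (1 <= c)%N) (hcm : (c <= m)%N) (hmN : (m < N)%N)
    (hcN : (c <= N - m)%N)
    (hY : max_neghyp N m c Y) :
  (* 1 is in the support *)
  ((1 <= maxn (m - c) (N - m - c))%N ->
     Pr Y 0 / Pr Y 1 = (c%:R + 1) / c%:R) /\
  is_local_mode (Pr Y) 0.
Proof.
have PrE y : Pr Y y = max_neghyp_prob R N m c y.
  by rewrite /Pr -[P _]/(distribution P Y [set y]%classic) hY.
have mcN : (m + c <= N)%N by lia.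
have gt0 := @card_draws0_gt0 N m c hcm mcN.
have ratio := @card_draws_ratio N m c.
have Sgt0 : (0 : R) < #|[set: 'S_N]|%:R.
  by rewrite ltr0n; apply/card_gt0P; exists 1%g.
split=> [y1 | j [-> | //]]; rewrite !PrE /max_neghyp_prob.
- have {}ratio := ratio ltac:(lia).
  move: gt0 ratio.
  set a := #|[set s | draws m c s == _ + 0]%N|.
  set b := #|[set s | draws m c s == _ + 1]%N| => gt0 ratio.
  have b0 : (b%:R : R) != 0 by rewrite pnatr_eq0; nia.
  have c0 : (c%:R : R) != 0 by rewrite pnatr_eq0; lia.
  rewrite -mulf_div divff ?invr_neq0 ?gt_eqF ?mulr1 //.
  apply/eqP; rewrite eqr_div // natr1 -!natrM eqr_nat; apply/eqP; lia.
- rewrite ltr_pM2r ?invr_gt0 // ltr_nat.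
  have [lt_cN | le_Nc] := ltnP (2 * c) N; first by have := ratio lt_cN; nia.
  rewrite [X in (X < _)%N](_ : _ = 0%N) //; apply/eqP; rewrite cards_eq0.
  apply/eqP/setP => s; rewrite !inE.
  by have := draws_leqN s hcm mcN; lia.
Qed.
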